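(* Let $\mathcal{G}$ be a finite undirected graph on the vertex set $\{1,\dots,n\}$ with edge weights $\gamma_{jk}=\gamma_{kj}>0$, let $\rho$ be the faithful state with density $D_\rho=\sum_{j=1}^n s_jE_{jj}$, and let $$\mathcal{L}(X)=\sum_{e_{jk}\in E(\mathcal{G})}\gamma_{jk}\left(\tfrac12\{V_{jk}^*V_{jk},X\}-V_{jk}^*XV_{jk}\right),\qquad V_{jk}=\sqrt{s_j}E_{jk}+\sqrt{s_k}E_{kj}.$$ Suppose that the semigroup $\Phi_t=e^{-t\mathcal{L}}$ is a primitive KMS-symmetric quantum Markov semigroup (with respect to $\rho$). Then $$\tfrac12\min\{\varphi_{\mathcal{G}},\phi_{\mathcal{G}}\}\;\le\;h_\rho(\mathcal{L})\;\le\;h_{\rho,\mathcal{G}}.$$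
   Context: $n\ge2$; $M_n(\mathbb{C})$ carries the unnormalized trace $\mathrm{Tr}$; $\{E_{jk}\}$ are the standard matrix units. The graph is simple (edges join two distinct vertices; $e_{jk}=e_{kj}$ and each edge is counted once in sums over $E(\mathcal{G})$), and $\gamma_{jk}=0$ if $e_{jk}\notin E(\mathcal{G})$. $s_1,\dots,s_n>0$, $\sum_js_j=1$, $\rho(X)=\mathrm{Tr}(D_\rho X)$. KMS inner product: $\langle X,Y\rangle_{\mathrm{KMS},\rho}=\mathrm{Tr}(X^*D_\rho^{1/2}YD_\rho^{1/2})$. A quantum Markov semigroup $\Phi_t=e^{-t\mathcal{L}}$ consists of unital completely positive maps; it is KMS-symmetric if each $\Phi_t$ is self-adjoint for $\langle\cdot,\cdot\rangle_{\mathrm{KMS},\rho}$, and primitive if it admits a faithful invariant state and $\ker\mathcal{L}=\mathbb{C}I$. $\{A,B\}=AB+BA$. Projection Dirichlet conductance: $h_\rho(\mathcal{L})=\inf_{P}\dfrac{\langle P,\mathcal{L}(P)\rangle_{\mathrm{KMS},\rho}}{\min\{\rho(P),1-\rho(P)\}}$ over orthogonal projections $P\in M_n(\mathbb{C})$, $P\ne0,I$. Weighted degrees: $d_j=\sum_{k:\,e_{jk}\in E(\mathcal{G})}\gamma_{jk}s_k$. Define $$\varphi_{\mathcal{G}}=\inf_{\vec t\ne0,\ \sum_js_jt_j=0}\frac{\sum_{e_{jk}\in E(\mathcal{G})}\gamma_{jk}s_js_k|t_j-t_k|^2}{\sum_{j=1}^ns_j|t_j|^2},$$ $$\phi_{\mathcal{G}}=\min_{j<k}\frac{2\sqrt{s_js_k}}{s_j+s_k}\left(\frac{d_j+d_k}2-\mathbb{1}_{e_{jk}\in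 E(\mathcal{G})}\gamma_{jk}\sqrt{s_js_k}\right),$$ $$h_{\rho,\mathcal{G}}=\min_{\emptyset\ne S\subsetneq\{1,\dots,n\}}\frac{\sum_{j\in S,\,k\notin S}\gamma_{jk}s_js_k}{\min\{\sum_{j\in S}s_j,\ \sum_{j\notin S}s_j\}}.$$ *)

(* Defs.v *)
From HB Require Import structures.
From mathcomp Require Import all_boot all_order all_algebra.
From mathcomp Require Import all_classical all_reals all_analysis.
From mathcomp Require Import complex.

Set Implicit Arguments.
Unset Strict Implicit.
Unset Printing Implicit Defensive.

Import Order.TTheory GRing.Theory Num.Theory.
Import numFieldNormedType.Exports.

Local Open Scope classical_set_scope.
Local Open Scope sesquilinear_scope.
Local Open Scope complex_scope.
Local Open Scope ring_scope.

Section Semigroups.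
Variable R : realType.
Local Notation C := R[i].

(* The order of R[i] makes [0 <= z] mean that z is real and nonnegative, so
   this implies that A is Hermitian. *)
Definition psdmx (N : nat) (A : 'M[C]_N) : Prop :=
  forall v : 'cV[C]_N, 0 <= (v^t* *m A *m v) ord0 ord0.

Section OnMatrices.
Variable n : nat.
Implicit Types (F L : 'M[C]_n -> 'M[C]_n) (Phi : R -> 'M[C]_n -> 'M[C]_n).

(* [F] amplified to M_m(M_n(C)), whose elements are the m x m block matrices
   with blocks in M_n(C). *)
Definition amplify (m : nat) F (A : 'M[C]_(\sum_(i < m) n)) :
    'M[C]_(\sum_(i < m) n) :=
  \mxblock_(i < m, j < m) F (submxblock A i j).

Definition completely_positive F : Prop :=
  forall (m : nat) (A : 'M[C]_(\sum_(i < m) n)), psdmx A -> psdmx (amplify F A).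

(* X |-> e^(-tL)(X), as the sum of the exponential series; R[i]^o is R[i] with
   the topology of its modulus. *)
Definition expsemigroup L (t : R) (X : 'M[C]_n) : 'M[C]_n :=
  limn (series (fun k : nat =>
    (((- t) ^+ k / k`!%:R)%:C *: iter k L X : 'M[C^o]_n))).

Definition quantum_markov Phi : Prop :=
  forall t : R, 0 <= t -> Phi t 1%:M = 1%:M /\ completely_positive (Phi t).

Definition state (omega : {scalar 'M[C]_n}) : Prop :=
  (forall X, psdmx X -> 0 <= omega X) /\ omega 1%:M = 1.

Definition faithful (omega : {scalar 'M[C]_n}) : Prop :=
  forall X, psdmx X -> omega X = 0 -> X = 0.

Definition primitive L : Prop :=
  (exists omega : {scalar 'M[C]_n},
     [/\ state omega, faithful omega &
         forall t X, 0 <= t -> omega (expsemigroup L t X) = omega X]) /\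
  (forall X, L X = 0 <-> exists c : C, X = c%:M).

Variable s : 'I_n -> R.

Definition density : 'M[C]_n := diag_mx (\row_j (s j)%:C).
Definition sqrt_density : 'M[C]_n := diag_mx (\row_j (Num.sqrt (s j))%:C).

Lemma sqrt_densityK : (forall j, 0 <= s j) ->
  sqrt_density *m sqrt_density = density.
Proof.
move=> s_ge0; rewrite mulmx_diag; congr diag_mx; apply/rowP => j.
by rewrite !mxE -rmorphM /= -expr2 sqr_sqrtr.
Qed.

Definition rho (X : 'M[C]_n) : C := \tr (density *m X).

Definition kms (X Y : 'M[C]_n) : C :=
  \tr (X^t* *m sqrt_density *m Y *m sqrt_density).

Definition kms_symmetric Phi : Prop :=
  forall t X Y, 0 <= t -> kms (Phi t X) Y = kms X (Phi t Y).

Definition orthogonal_projection (P : 'M[C]_n) : Prop :=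
  P *m P = P /\ P^t* = P.

(* rho P is real when P is Hermitian, and so is kms P (L P) when L is
   KMS-symmetric. *)
Definition dirichlet_conductance L : \bar R :=
  ereal_inf [set (complex.Re (kms P (L P)) /
                  Num.min (complex.Re (rho P)) (1 - complex.Re (rho P)))%:E
    | P in [set P | orthogonal_projection P /\ P <> 0 /\ P <> 1%:M]].

End OnMatrices.
End Semigroups.

Section WeightedGraph.
Variables (R : realType) (n : nat).
Local Notation C := R[i].
Variables (E : rel 'I_n) (gamma : 'I_n -> 'I_n -> R) (s : 'I_n -> R).

Definition anticomm (A B : 'M[C]_n) : 'M[C]_n := A *m B + B *m A.

Definition jump (j k : 'I_n) : 'M[C]_n :=
  (Num.sqrt (s j))%:C *: delta_mx j k + (Num.sqrt (s k))%:C *: delta_mx k j.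

(* Ordered pairs j < k count each undirected edge once. *)
Definition graph_generator (X : 'M[C]_n) : 'M[C]_n :=
  \sum_(j < n) \sum_(k < n | (j < k)%N && E j k)
    (gamma j k)%:C *:
      (2^-1 *: anticomm ((jump j k)^t* *m jump j k) X
       - (jump j k)^t* *m X *m jump j k).

Definition wdegree (j : 'I_n) : R := \sum_(k < n | E j k) gamma j k * s k.

Definition normsq (z : C) : R := complex.Re `|z| ^+ 2.

Definition graph_gap : \bar R :=
  ereal_inf [set ((\sum_(j < n) \sum_(k < n | (j < k)%N && E j k)
                     gamma j k * s j * s k * normsq (t ord0 j - t ord0 k)) /
                  (\sum_(j < n) s j * normsq (t ord0 j)))%:E
    | t in [set t : 'rV[C]_n |
        t <> 0 /\ \sum_(j < n) (s j)%:C * t ord0 j = 0]].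

(* Minima over finite index sets; +oo is the value on the empty set, which
   does not occur for n >= 2. *)
Definition graph_offdiag : \bar R :=
  \big[Order.min/+oo%E]_(p : 'I_n * 'I_n | (p.1 < p.2)%N)
    (2 * Num.sqrt (s p.1 * s p.2) / (s p.1 + s p.2) *
     ((wdegree p.1 + wdegree p.2) / 2
      - (E p.1 p.2)%:R * gamma p.1 p.2 * Num.sqrt (s p.1 * s p.2)))%:E.

Definition graph_conductance : \bar R :=
  \big[Order.min/+oo%E]_(S : {set 'I_n} | (0 < #|S| < n)%N)
    ((\sum_(j in S) \sum_(k | k \notin S) gamma j k * s j * s k) /
     Num.min (\sum_(j in S) s j) (\sum_(j | j \notin S) s j))%:E.

End WeightedGraph.

(* Main.v *)
Require Import Defs.
From mathcomp Require Import all_boot all_order all_algebra.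
From mathcomp Require Import all_classical all_reals all_analysis.
From mathcomp Require Import complex ring lra.

Import Order.TTheory GRing.Theory Num.Theory.
Import numFieldNormedType.Exports.
Local Open Scope ring_scope.

(* L acts on the diagonal entries of X as the weighted graph Laplacian, and it
   couples an off-diagonal entry X_ab only with X_ba.  For Hermitian P the
   energy <P, L P> is therefore the graph energy of the diagonal of P plus a
   sum over the off-diagonal entries.  For a projection P, the first part is at
   least the graph gap times the variance of the diagonal, and the second at
   least the off-diagonal constant times the s_a |P_ab|^2 with a != b; since
   P = P^2, the variance and this sum add up to rho(P) (1 - rho(P)), which is
   at least half of min(rho(P), 1 - rho(P)).  The upper bound comes from the
   diagonal projections onto vertex sets. *)

(** * Real parts and squared moduli of complex numbers *)

Section ComplexParts.
Local Open Scope complex_scope.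
Variable R : realType.
Implicit Types (x : R) (z : R[i]).

Lemma conjE (a b : R) : Num.conj (a +i* b) = a -i* b.
Proof. by []. Qed.

Lemma Re_sum (I : Type) (r : seq I) (Q : pred I) (F : I -> R[i]) :
  complex.Re (\sum_(i <- r | Q i) F i) = \sum_(i <- r | Q i) complex.Re (F i).
Proof. by apply: (big_morph _ _ (erefl _)) => -[? ?] [? ?]. Qed.

Lemma normsqE z : normsq z = complex.Re z ^+ 2 + complex.Im z ^+ 2.
Proof.
by case: z => a b; rewrite /normsq normc_def /= sqr_sqrtr // addr_ge0 ?sqr_ge0.
Qed.

Lemma normsq_ge0 z : 0 <= normsq z.
Proof. exact: sqr_ge0. Qed.

Lemma normsqC z : normsq (Num.conj z) = normsq z.
Proof. by case: z => a b; rewrite conjE !normsqE /= sqrrN. Qed.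

Lemma normsq_eq0 z : normsq z = 0 -> z = 0.
Proof.
case: z => a b; rewrite normsqE /= => /eqP.
by rewrite paddr_eq0 ?sqr_ge0 // !sqrf_eq0 => /andP[/eqP-> /eqP->].
Qed.

Lemma Re_mulconj z : complex.Re (Num.conj z * z) = normsq z.
Proof. by case: z => a b; rewrite conjE normsqE /=; ring. Qed.

(** For [z = a + ib] the left side is [a^2 - b^2]. This controls the coupling of an off-diagonal
    entry with its transpose. *)
Lemma Re_sqr_le z : complex.Re (z * z) <= normsq z.
Proof. by case: z => a b; rewrite normsqE /=; have := sqr_ge0 b; nra. Qed.

Lemma ReB z z' : complex.Re (z - z') = complex.Re z - complex.Re z'.
Proof. by case: z z' => [? ?] [? ?]. Qed.

Lemma Re_mulrC x z : complex.Re (x%:C * z) = x * complex.Re z.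
Proof. by case: z => a b /=; ring. Qed.

Lemma real_fixed z : Num.conj z = z -> z = (complex.Re z)%:C.
Proof. by case: z => a b; rewrite conjE => -[] hb; congr (_ +i* _); lra. Qed.

End ComplexParts.

(** * Edge sums and products with matrix units *)

Lemma sum_symmetric_edges (V : nmodType) (n : nat) (E : rel 'I_n)
    (E_sym : symmetric E) (E_irr : irreflexive E) (F : 'I_n -> 'I_n -> V) :
  \sum_(j < n) \sum_(k < n | (j < k)%N && E j k) (F j k + F k j) =
  \sum_(j < n) \sum_(k < n | E j k) F j k.
Proof.
under eq_bigr do rewrite big_split /=.
(* Exchanging the summations turns the reversed terms [F k j] into the pairs with second index below
   the first; irreflexivity excludes the remaining case of equal indices. *)
rewrite big_split /= [X in _ + X = _](exchange_big_dep xpredT) //= -big_split /=.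
apply: eq_bigr => j _; rewrite [RHS](bigID (fun k : 'I_n => (j < k)%N)) /=.
congr (_ + _); apply: eq_bigl => k; first by rewrite andbC.
by rewrite E_sym andbC; case: ltngtP => // /ord_inj ->; rewrite E_irr.
Qed.

Lemma mulmx_delta2 (R : pzRingType) (m n p q : nat) (i : 'I_m) (j : 'I_n)
    (k : 'I_p) (l : 'I_q) (A : 'M[R]_(n, p)) :
  delta_mx i j *m A *m delta_mx k l = A j k *: delta_mx i l.
Proof.
apply/matrixP => a b; rewrite !mxE (bigD1 k) //= big1 => [|c /negPf ck].
  rewrite !mxE (bigD1 j) //= big1 => [|c /negPf cj]; last first.
    by rewrite !mxE cj andbF mul0r.
  rewrite !mxE !eqxx andbT !addr0.
  by case: (a == i); case: (b == l); rewrite ?(mul0r, mul1r, mulr0, mulr1).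
by rewrite !mxE ck mulr0.
Qed.

(** This is the sandwich [V^* A V] of a jump operator, with the square roots of the weights
    abstracted to [x] and [y]. *)
Lemma delta_combination_conj (K : comPzRingType) (n : nat) (x y : K)
    (j k : 'I_n) (A : 'M[K]_n) :
  (x *: delta_mx k j + y *: delta_mx j k) *m A *m
    (x *: delta_mx j k + y *: delta_mx k j) =
  (x * x * A j j) *: delta_mx k k + (y * y * A k k) *: delta_mx j j +
  ((x * y * A j k) *: delta_mx k j + (x * y * A k j) *: delta_mx j k).
Proof.
rewrite !mulmxDl !mulmxDr -!scalemxAl -!scalemxAr.
rewrite !mulmx_delta2 !scalerA [y * x]mulrC.
by rewrite -!addrA; congr (_ + _); rewrite addrA addrC.
Qed.

Lemma mulmx_delta_diagl (K : pzRingType) (n : nat) (i a b : 'I_n) (A : 'M[K]_n) :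
  (delta_mx i i *m A) a b = (a == i)%:R * A a b.
Proof.
rewrite !mxE (bigD1 a) //= !mxE big1 ?addr0 => [|c /negPf ca].
  by case: (a == i).
by rewrite !mxE; case: eqVneq => [<-|]; rewrite ?ca mul0r.
Qed.

Lemma mulmx_delta_diagr (K : pzRingType) (n : nat) (i a b : 'I_n) (A : 'M[K]_n) :
  (A *m delta_mx i i) a b = A a b * (b == i)%:R.
Proof.
rewrite !mxE (bigD1 b) //= !mxE big1 ?addr0 => [|c /negPf cb].
  by case: (b == i).
by rewrite !mxE; case: (eqVneq b i) => [<-|]; rewrite ?cb ?andbF mulr0.
Qed.

(** This is the shape of one summand of the generator. With free coefficients, [ring] closes the
    goal once both products with [D] are rewritten as Kronecker symbols times [A a b]. *)
Lemma edge_term_entry (K : comPzRingType) (n : nat) (g h x y u v w t : K)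
    (j k a b : 'I_n) (A : 'M[K]_n) :
  let D := x *: delta_mx k k + y *: delta_mx j j in
  (g *: (h *: (D *m A + A *m D) -
    (u *: delta_mx k k + v *: delta_mx j j +
     (w *: delta_mx k j + t *: delta_mx j k)))) a b =
  g * (h * ((x * ((a == k)%:R + (b == k)%:R) +
             y * ((a == j)%:R + (b == j)%:R)) * A a b) -
       (u * ((a == k) && (b == k))%:R + v * ((a == j) && (b == j))%:R +
        (w * ((a == k) && (b == j))%:R + t * ((a == j) && (b == k))%:R))).
Proof.
move=> D.
have Dl : (D *m A) a b = (x * (a == k)%:R + y * (a == j)%:R) * A a b.
  rewrite /D mulmxDl -!scalemxAl mxE [X in X + _]mxE [X in _ + X]mxE.
  by rewrite !mulmx_delta_diagl mulrDl !mulrA.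
have Dr : (A *m D) a b = (x * (b == k)%:R + y * (b == j)%:R) * A a b.
  rewrite /D mulmxDr -!scalemxAr mxE [X in X + _]mxE [X in _ + X]mxE.
  by rewrite !mulmx_delta_diagr mulrDl; congr (_ + _); ring.
move: (D *m A) (A *m D) Dl Dr => M N Dl Dr.
by rewrite !mxE Dl Dr; ring.
Qed.

Lemma sum_delta (K : pzSemiRingType) (n : nat) (a : 'I_n) (F : 'I_n -> K) :
  \sum_(j < n) F j * (a == j)%:R = F a.
Proof.
rewrite (bigD1 a) //= eqxx mulr1 big1 ?addr0 // => j /negPf ja.
by rewrite eq_sym ja mulr0.
Qed.

(** * The generator in matrix entries, and its energy on Hermitian matrices *)

Section Energy.
Local Open Scope complex_scope.
Local Open Scope sesquilinear_scope.
Variables (R : realType) (n : nat) (E : rel 'I_n).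
Variables (gamma : 'I_n -> 'I_n -> R) (s : 'I_n -> R).
Hypothesis E_sym : symmetric E.
Hypothesis E_irr : irreflexive E.
Hypothesis gamma_sym : forall j k, gamma j k = gamma k j.
Hypothesis gamma_eq0 : forall j k, ~~ E j k -> gamma j k = 0.
Hypothesis s_gt0 : forall j, 0 < s j.

Local Notation C := R[i].
Local Notation r j := (Num.sqrt (s j)).
Local Notation d := (wdegree E gamma s).

Lemma sqrt_weightK j : r j * r j = s j.
Proof. by rewrite -expr2 sqr_sqrtr // ltW. Qed.

Lemma jump_adjoint j k :
  (jump s j k)^t* = (r j)%:C *: delta_mx k j + (r k)%:C *: delta_mx j k.
Proof.
rewrite /jump; apply/matrixP => a b; rewrite !mxE rmorphD !rmorphM /= !rmorph_nat.
have real_conj (x : R) : Num.conj x%:C = x%:C by exact: conjc_real.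
by rewrite !real_conj [(b == j) && _]andbC [(b == k) && _]andbC.
Qed.

Lemma jump_conj j k (X : 'M[C]_n) :
  (jump s j k)^t* *m X *m jump s j k =
  ((s j)%:C * X j j) *: delta_mx k k + ((s k)%:C * X k k) *: delta_mx j j +
  (((r j * r k)%:C * X j k) *: delta_mx k j +
   ((r j * r k)%:C * X k j) *: delta_mx j k).
Proof.
by rewrite jump_adjoint delta_combination_conj -!rmorphM /= !sqrt_weightK.
Qed.

Lemma jump_square j k : j != k ->
  (jump s j k)^t* *m jump s j k =
  (s j)%:C *: delta_mx k k + (s k)%:C *: delta_mx j j.
Proof.
move=> /negPf jk; have kj : (k == j) = false by rewrite eq_sym.
(* The identity is inserted as the middle factor; its entries at [(j, k)] and [(k, j)] vanish, which
   removes the cross terms. *)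
rewrite -[_^t*]mulmx1 jump_conj !mxE !eqxx jk kj.
by rewrite !mulr0 !mulr1 !scale0r !addr0.
Qed.

Lemma graph_generatorE (X : 'M[C]_n) a b :
  graph_generator E gamma s X a b =
  2^-1 * ((d a)%:C + (d b)%:C) * X a b
  - (a == b)%:R * (\sum_(k < n | E a k) (gamma a k * s k)%:C * X k k)
  - (gamma a b * (r a * r b))%:C * X b a.
Proof.
(* [G j k] is the share of the edge attached to its endpoint [j], so that [G j k + G k j] is the
   whole edge term at entry [(a, b)]. *)
pose G j k := (gamma j k * s k)%:C * (2^-1 * X a b) * ((a == j)%:R + (b == j)%:R)
  - (gamma j k * s k)%:C * X k k * ((a == j) && (b == j))%:R
  - (gamma j k * (r j * r k))%:C * X k j * ((a == j) && (b == k))%:R.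
rewrite /graph_generator summxE.
transitivity (\sum_(j < n) \sum_(k < n | (j < k)%N && E j k) (G j k + G k j)).
  apply: eq_bigr => j _; rewrite summxE; apply: eq_bigr => k /andP[jk _].
  have njk : j != k by rewrite neq_ltn jk.
  rewrite jump_square // jump_conj /anticomm edge_term_entry.
  rewrite /G [gamma k j]gamma_sym [r k * r j]mulrC.
  rewrite [(a == k) && (b == j)]andbC !rmorphM /=; ring.
rewrite (sum_symmetric_edges _ _ _ E_sym E_irr).
(* After summation over [k], every term carries an indicator that [j] is [a] or [b], and [sum_delta]
   collapses the outer sum. *)
transitivity (\sum_(j < n)
  ((2^-1 * X a b) * (d j)%:C * (a == j)%:R + (2^-1 * X a b) * (d j)%:C * (b == j)%:R
  - (a == b)%:R * (\sum_(k < n | E j k) (gamma j k * s k)%:C * X k k) * (a == j)%:R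
  - (gamma j b * (r j * r b))%:C * X b j * (a == j)%:R)).
  apply: eq_bigr => j _; rewrite /G !sumrB -!mulr_suml.
  congr (_ - _ - _).
  - by rewrite /wdegree rmorph_sum; ring.
  - have -> : (a == j) && (b == j) = (a == b) && (a == j).
      by case: (eqVneq a j) => [->|]; rewrite ?andbF ?andbT // eq_sym.
    by rewrite -mulnb natrM; ring.
  (* Since [gamma] vanishes off the edges, the sum may run over all [k], and the indicator of
     [b == k] selects one term. *)
  - rewrite big_mkcond /= -[RHS](sum_delta _ _ b (fun k =>
      (gamma j k * (r j * r k))%:C * X k j * (a == j)%:R)).
    apply: eq_bigr => k _; rewrite -mulnb natrM.
    case: ifPn => [_|/gamma_eq0 ->]; first by rewrite mulrA.
    by rewrite !mul0r.
rewrite !sumrB big_split /= !sum_delta; ring.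
Qed.

Lemma kmsE (X Y : 'M[C]_n) :
  kms s X Y = \sum_(a < n) \sum_(b < n) (r a * r b)%:C * (Num.conj (X a b) * Y a b).
Proof.
rewrite /kms /mxtrace exchange_big /=; apply: eq_bigr => b _.
rewrite /sqrt_density mul_mx_diag !mxE mulr_suml; apply: eq_bigr => a _.
rewrite mul_mx_diag !mxE !rmorphM /=; ring.
Qed.

Lemma wdegree_ge a b : (forall j k, 0 <= gamma j k) -> gamma a b * s b <= d a.
Proof.
move=> gamma_ge0; have term_ge0 k : 0 <= gamma a k * s k by rewrite mulr_ge0 // ltW.
case: (boolP (E a b)) => [Eab|/gamma_eq0->].
  by rewrite /wdegree (bigD1 b) //= lerDl sumr_ge0.
by rewrite mul0r sumr_ge0.
Qed.

(** The degrees satisfy [d a >= gamma a b * s b] and [d b >= gamma a b * s a], and the rest is the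
    inequality of arithmetic and geometric means, in the form [gamma a b * (r a - r b)^2 >= 0]. *)
Lemma offdiag_ge0 a b : (forall j k, 0 <= gamma j k) ->
  0 <= (d a + d b) / 2 - gamma a b * (r a * r b).
Proof.
move=> gamma_ge0.
have dab := wdegree_ge a b gamma_ge0; have dba := wdegree_ge b a gamma_ge0.
have := mulr_ge0 (gamma_ge0 a b) (sqr_ge0 (r a - r b)).
rewrite sqrrB !sqr_sqrtr ?(ltW (s_gt0 _)) // => sq_ge0.
by move: dba; rewrite gamma_sym; lra.
Qed.

Lemma rhoE (X : 'M[C]_n) : rho s X = \sum_(a < n) (s a)%:C * X a a.
Proof.
by rewrite /rho /density mul_diag_mx; apply: eq_bigr => a _; rewrite !mxE.
Qed.

Section HermitianArgument.
Variable P : 'M[C]_n.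
Hypothesis P_herm : P^t* = P.

Lemma hermitian_entry a b : Num.conj (P a b) = P b a.
Proof. by rewrite -[P in RHS]P_herm !mxE. Qed.

Lemma hermitian_diag a : P a a = (complex.Re (P a a))%:C.
Proof. exact/real_fixed/hermitian_entry. Qed.

Lemma normsq_hermitian a b : normsq (P a b) = normsq (P b a).
Proof. by rewrite -normsqC hermitian_entry. Qed.

(** The diagonal entries are real and see only the graph Laplacian. Off the diagonal, the conjugate
    of [P a b] is [P b a], so the degree term yields a squared modulus and the coupling term the
    square of [P b a]. *)
Lemma kms_energy :
  complex.Re (kms s P (graph_generator E gamma s P)) =
  \sum_(j < n) \sum_(k < n | (j < k)%N && E j k)
     gamma j k * s j * s k * normsq (P j j - P k k) +
  \sum_(a < n) \sum_(b < n | b != a)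
     r a * r b * ((d a + d b) / 2 * normsq (P a b)
                  - gamma a b * (r a * r b) * complex.Re (P b a * P b a)).
Proof.
pose x a := complex.Re (P a a).
have Px a : P a a = (x a)%:C by exact: hermitian_diag.
have gamma_diag a : gamma a a = 0 by rewrite gamma_eq0 ?E_irr.
transitivity (\sum_(a < n) \sum_(k < n | E a k)
    gamma a k * s a * s k * (x a * x a - x a * x k) +
  \sum_(a < n) \sum_(b < n | b != a)
     r a * r b * ((d a + d b) / 2 * normsq (P a b)
                  - gamma a b * (r a * r b) * complex.Re (P b a * P b a))).
  rewrite kmsE Re_sum -big_split; apply: eq_bigr => a _.
  rewrite Re_sum (bigD1 a) //=; congr (_ + _).
    rewrite Re_mulrC hermitian_entry graph_generatorE eqxx gamma_diag sqrt_weightK.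
    have -> : \sum_(k < n | E a k) (gamma a k * s k)%:C * P k k =
        (\sum_(k < n | E a k) gamma a k * s k * x k)%:C.
      by rewrite rmorph_sum; apply: eq_bigr => k _; rewrite Px -rmorphM.
    rewrite Px; have -> : (2^-1 : C) = (2^-1)%:C by rewrite fmorphV rmorph_nat.
    rewrite !mul0r subr0 mul1r Re_mulrC ReB -rmorphD -!rmorphM /=.
    rewrite /wdegree; set u := \sum_(k < n | _) gamma a k * s k.
    transitivity (s a * (x a * x a * u -
       x a * \sum_(k < n | E a k) gamma a k * s k * x k)); first by field.
    rewrite /u !mulr_sumr -sumrB mulr_sumr; apply: eq_bigr => k _; ring.
  apply: eq_bigr => b /negPf ba.
  rewrite Re_mulrC graph_generatorE eq_sym ba mul0r subr0; congr (_ * _).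
  have -> : (2^-1 : C) = (2^-1)%:C by rewrite fmorphV rmorph_nat.
  rewrite -rmorphD -rmorphM /= mulrBr ReB mulrCA Re_mulrC Re_mulconj.
  by rewrite hermitian_entry [P b a * (_ * _)]mulrCA Re_mulrC [_^-1 * _]mulrC.
(* The two orientations of an edge add up to [(x j - x k)^2]. *)
congr (_ + _); rewrite -(sum_symmetric_edges _ _ _ E_sym E_irr).
apply: eq_bigr => j _; apply: eq_bigr => k _.
rewrite !Px [gamma k j]gamma_sym normsqE /=; ring.
Qed.

(** Here [c] stands for a common real lower bound of the graph gap and the off-diagonal constant,
    whose quotients are cleared of denominators. The bracket splits into the variance of the
    diagonal and the off-diagonal mass, and each is bounded separately. *)
Lemma hermitian_energy_ge (c : R) :
  \sum_(j < n) s j = 1 ->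
  (forall t : 'rV[C]_n, \sum_(j < n) (s j)%:C * t ord0 j = 0 ->
    c * (\sum_(j < n) s j * normsq (t ord0 j)) <=
    \sum_(j < n) \sum_(k < n | (j < k)%N && E j k)
      gamma j k * s j * s k * normsq (t ord0 j - t ord0 k)) ->
  (forall a b, a != b -> c * (s a + s b) <=
    2 * (r a * r b) * ((d a + d b) / 2 - gamma a b * (r a * r b))) ->
  (forall a b, 0 <= gamma a b) ->
  c * (\sum_(a < n) \sum_(b < n) s a * normsq (P a b)
       - complex.Re (rho s P) ^+ 2) <=
  complex.Re (kms s P (graph_generator E gamma s P)).
Proof.
move=> s_sum1 gap offdiag gamma_ge0.
pose x a := complex.Re (P a a); pose m := \sum_(a < n) s a * x a.
have Px a : P a a = (x a)%:C by exact: hermitian_diag.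
have -> : complex.Re (rho s P) = m.
  by rewrite rhoE Re_sum; apply: eq_bigr => a _; rewrite Re_mulrC.
have diag_ge : c * (\sum_(j < n) s j * x j ^+ 2 - m ^+ 2) <=
    \sum_(j < n) \sum_(k < n | (j < k)%N && E j k)
      gamma j k * s j * s k * normsq (P j j - P k k).
  (* Centering at [m] makes the weighted mean zero, as the gap inequality requires. It leaves the
     edge differences unchanged and, as the weights sum to 1, turns the weighted square norm into
     the variance. *)
  pose t : 'rV[C]_n := \row_j (x j - m)%:C.
  have mean : \sum_(j < n) (s j)%:C * t ord0 j = 0.
    transitivity ((\sum_(j < n) s j * (x j - m))%:C).
      by rewrite rmorph_sum; apply: eq_bigr => j _; rewrite mxE -rmorphM.
    under eq_bigr do rewrite mulrBr.
    by rewrite sumrB -mulr_suml s_sum1 mul1r subrr.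
  have := gap t mean; congr (_ * _ <= _).
    transitivity (\sum_(j < n)
        (s j * x j ^+ 2 - 2 * m * (s j * x j) + m ^+ 2 * s j)).
      apply: eq_bigr => j _; rewrite mxE normsqE /=; ring.
    rewrite big_split sumrB /= -!mulr_sumr s_sum1 -/m; ring.
  apply: eq_bigr => j _; apply: eq_bigr => k _; congr (_ * normsq _).
  by rewrite !mxE !Px -rmorphB -[in RHS]rmorphB /=; congr (_%:C); ring.
rewrite kms_energy.
have off_ge : c * (\sum_(a < n) \sum_(b < n | b != a) s a * normsq (P a b)) <=
    \sum_(a < n) \sum_(b < n | b != a)
     r a * r b * ((d a + d b) / 2 * normsq (P a b)
                  - gamma a b * (r a * r b) * complex.Re (P b a * P b a)).
  (* As [P a b] and [P b a] have equal modulus, the weight [s a] can be averaged with [s b], which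
     produces the [s a + s b] of the off-diagonal bound. *)
  have -> : \sum_(a < n) \sum_(b < n | b != a) s a * normsq (P a b) =
     \sum_(a < n) \sum_(b < n | b != a) (s a + s b) / 2 * normsq (P a b).
    set S := LHS.
    have S' : S = \sum_(a < n) \sum_(b < n | b != a) s b * normsq (P a b).
      rewrite /S (exchange_big_dep xpredT) //=; apply: eq_bigr => a _.
      by apply: eq_big => [b|b _]; [rewrite eq_sym|rewrite normsq_hermitian].
    transitivity ((S + S) / 2); first by field.
    rewrite {2}S' /S -big_split mulr_suml; apply: eq_bigr => a _ /=.
    rewrite -big_split mulr_suml; apply: eq_bigr => b _ /=.
    by field.
  rewrite mulr_sumr; apply: ler_sum => a _.
  rewrite mulr_sumr; apply: ler_sum => b ba.
  have := offdiag a b; rewrite eq_sym => /(_ ba) ab_ge.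
  have q_ge0 := normsq_ge0 _ (P a b).
  have g_ge0 : 0 <= gamma a b * (r a * r b) by rewrite !mulr_ge0 ?sqrtr_ge0.
  have r_ge0 : 0 <= r a * r b by rewrite mulr_ge0 ?sqrtr_ge0.
  (* The coupling term thus subtracts at most [gamma a b * (r a * r b)] times the squared modulus of
     [P a b]. *)
  have := Re_sqr_le _ (P b a); rewrite -normsq_hermitian => sqr_le.
  have {}sqr_le := ler_wpM2l r_ge0 (ler_wpM2l g_ge0 sqr_le).
  have := ler_wpM2r q_ge0 ab_ge; lra.
have -> : \sum_(a < n) \sum_(b < n) s a * normsq (P a b) =
    \sum_(j < n) s j * x j ^+ 2 +
    \sum_(a < n) \sum_(b < n | b != a) s a * normsq (P a b).
  rewrite -big_split; apply: eq_bigr => a _; rewrite (bigD1 a) //=.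
  by congr (_ * _ + _); rewrite Px normsqE /= expr0n addr0.
by rewrite addrAC mulrDr lerD.
Qed.

End HermitianArgument.

End Energy.

(** * The state evaluated on orthogonal projections *)

Section Projections.
Local Open Scope complex_scope.
Local Open Scope sesquilinear_scope.
Variables (R : realType) (n : nat).
Local Notation C := R[i].
Variable P : 'M[C]_n.
Hypothesis P_proj : orthogonal_projection P.

(** This reads the diagonal of [P = P P^*], which combines idempotence with self-adjointness. *)
Lemma projection_diag a : complex.Re (P a a) = \sum_(b < n) normsq (P a b).
Proof.
have [P_idem P_herm] := P_proj.
rewrite -{1}P_idem mxE Re_sum; apply: eq_bigr => b _.
by rewrite -(hermitian_entry _ _ _ P_herm b a) Re_mulconj normsqC.
Qed.

(** It turns the bracket of [hermitian_energy_ge] into [rho(P) - rho(P)^2]. *)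
Lemma rho_projection (s : 'I_n -> R) :
  complex.Re (rho s P) = \sum_(a < n) \sum_(b < n) s a * normsq (P a b).
Proof.
rewrite rhoE Re_sum; apply: eq_bigr => a _.
by rewrite Re_mulrC projection_diag mulr_sumr.
Qed.

(** Applied to [P] and to [1 - P], it makes the denominator of the conductance quotient positive. *)
Lemma rho_projection_gt0 (s : 'I_n -> R) :
  (forall j, 0 < s j) -> P <> 0 -> 0 < complex.Re (rho s P).
Proof.
move=> s_gt0 P0; rewrite rho_projection lt_neqAle; apply/andP; split; last first.
  by do 2!(apply: sumr_ge0 => ? _); rewrite mulr_ge0 ?normsq_ge0 // ltW.
rewrite eq_sym; apply/negP => /eqP sum0; apply: P0; apply/matrixP => a b.
have term_ge0 i j : 0 <= s i * normsq (P i j).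
  by rewrite mulr_ge0 ?normsq_ge0 // ltW.
have row0 : \sum_(j < n) s a * normsq (P a j) = 0.
  by apply: (psumr_eq0P _ sum0) => // i _; apply: sumr_ge0 => j _.
have /eqP : s a * normsq (P a b) = 0 by apply: (psumr_eq0P _ row0) => // j _.
by rewrite mulf_eq0 (gt_eqF (s_gt0 a)) /= mxE => /eqP/normsq_eq0.
Qed.

End Projections.

Lemma orthogonal_projectionB (R : realType) (n : nat) (P : 'M[R[i]]_n) :
  orthogonal_projection P -> orthogonal_projection (1%:M - P).
Proof.
move=> [P_idem P_herm]; split.
  by rewrite mulmxBl mul1mx mulmxBr mulmx1 P_idem subrr subr0.
rewrite -[in RHS]P_herm; apply/matrixP => a b.
by rewrite !mxE rmorphB rmorph_nat eq_sym.
Qed.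

Lemma rhoB (R : realType) (n : nat) (s : 'I_n -> R) (P : 'M[R[i]]_n) :
  \sum_(j < n) s j = 1 ->
  complex.Re (rho s (1%:M - P)) = 1 - complex.Re (rho s P).
Proof.
move=> s_sum1; rewrite !rhoE !Re_sum -[1 in RHS]s_sum1 -sumrB.
by apply: eq_bigr => j _; rewrite !Re_mulrC !mxE eqxx ReB /= mulrBr mulr1.
Qed.

(** * Diagonal projections onto vertex sets *)

Section IndicatorProjection.
Local Open Scope complex_scope.
Local Open Scope sesquilinear_scope.
Variables (R : realType) (n : nat) (S : {set 'I_n}).

Definition indicator_mx : 'M[R[i]]_n := diag_mx (\row_j (j \in S)%:R).

Lemma indicator_mxE a b : indicator_mx a b = ((a \in S) && (a == b))%:R.
Proof. by rewrite !mxE; case: (a \in S); case: (a == b). Qed.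

Lemma indicator_mx_projection : orthogonal_projection indicator_mx.
Proof.
split; last first.
  apply/matrixP => a b; rewrite !mxE rmorphMn rmorph_nat /=.
  by case: eqVneq => [->|].
rewrite /indicator_mx mulmx_diag; congr diag_mx; apply/rowP => j.
by rewrite !mxE -natrM mulnb andbb.
Qed.

Lemma rho_indicator (s : 'I_n -> R) :
  complex.Re (rho s indicator_mx) = \sum_(j in S) s j.
Proof.
rewrite rhoE Re_sum [RHS]big_mkcond; apply: eq_bigr => j _.
by rewrite Re_mulrC indicator_mxE eqxx andbT; case: (j \in S); rewrite ?mulr1 ?mulr0.
Qed.

(** The off-diagonal part of [kms_energy] vanishes, and the squared difference of two diagonal
    entries is 1 exactly when the pair crosses the cut. *)
Lemma indicator_energy (E : rel 'I_n) (gamma : 'I_n -> 'I_n -> R)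
    (s : 'I_n -> R) :
  symmetric E -> irreflexive E -> (forall j k, gamma j k = gamma k j) ->
  (forall j k, ~~ E j k -> gamma j k = 0) -> (forall j, 0 < s j) ->
  complex.Re (kms s indicator_mx (graph_generator E gamma s indicator_mx)) =
  \sum_(j in S) \sum_(k | k \notin S) gamma j k * s j * s k.
Proof.
move=> E_sym E_irr gamma_sym gamma_eq0 s_gt0.
have [_ P_herm] := indicator_mx_projection.
rewrite (kms_energy _ _ _ _ _ E_sym E_irr gamma_sym gamma_eq0 s_gt0 _ P_herm).
rewrite [X in _ + X]big1 ?addr0 => [|a _]; last first.
  rewrite big1 // => b ba; rewrite !indicator_mxE (negPf ba) eq_sym (negPf ba).
  by rewrite !andbF mulr0 normsqE /= expr0n addr0 !mulr0 subr0 mulr0.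
(* Each cut edge is counted from its endpoint in [S], so exactly one of [F j k] and [F k j] can be
   nonzero for it. *)
pose F j k := gamma j k * s j * s k * ((j \in S) && (k \notin S))%:R.
transitivity (\sum_(j < n) \sum_(k < n | (j < k)%N && E j k) (F j k + F k j)).
  apply: eq_bigr => j _; apply: eq_bigr => k _.
  rewrite /F !indicator_mxE !eqxx !andbT [gamma k j]gamma_sym normsqE.
  by case: (j \in S); case: (k \in S) => /=; ring.
rewrite sum_symmetric_edges // [RHS]big_mkcond; apply: eq_bigr => j _.
rewrite big_mkcond /F; case: (j \in S) => /=; last first.
  by rewrite big1 // => k _; rewrite mulr0 if_same.
rewrite [RHS]big_mkcond; apply: eq_bigr => k _.
case: ifPn => [_|/gamma_eq0->]; first by case: (k \in S); rewrite ?mulr0 ?mulr1.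
by rewrite !mul0r if_same.
Qed.

End IndicatorProjection.

(** * Comparison of the conductance with the graph constants *)

Theorem proposition4p1 (R : realType) (n : nat) (n_ge2 : (2 <= n)%N)
  (E : rel 'I_n) (E_sym : symmetric E) (E_irr : irreflexive E)
  (gamma : 'I_n -> 'I_n -> R)
  (gamma_sym : forall j k, gamma j k = gamma k j)
  (gamma_gt0 : forall j k, E j k -> 0 < gamma j k)
  (gamma_eq0 : forall j k, ~~ E j k -> gamma j k = 0)
  (s : 'I_n -> R) (s_gt0 : forall j, 0 < s j) (s_sum1 : \sum_(j < n) s j = 1)
  (L_qms : quantum_markov (expsemigroup (graph_generator E gamma s)))
  (L_kms : kms_symmetric s (expsemigroup (graph_generator E gamma s)))
  (L_prim : primitive (graph_generator E gamma s)) :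
  ((2^-1)%:E * Order.min (graph_gap E gamma s) (graph_offdiag E gamma s)
     <= dirichlet_conductance s (graph_generator E gamma s))%E /\
  (dirichlet_conductance s (graph_generator E gamma s)
     <= graph_conductance gamma s)%E.
Proof.
have gamma_ge0 a b : 0 <= gamma a b.
  by case: (boolP (E a b)) => [/gamma_gt0/ltW|/gamma_eq0->].
have s_ge0 j : 0 <= s j by exact: ltW.
have edge_ge0 j k z : 0 <= gamma j k * s j * s k * normsq z.
  by rewrite mulr_ge0 ?normsq_ge0 // !mulr_ge0.
split; last first.
  (* The upper bound holds for the default [+oo] and passes to binary minima, which leaves a single
     vertex set [S]. *)
  rewrite /graph_conductance; elim/big_ind: _ => [|x y le_x le_y|S /andP[S_gt0 S_ltn]].
  - exact: leey.
  - by rewrite le_min le_x.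
  apply: ereal_inf_lbound; exists (indicator_mx R n S); last first.
    rewrite indicator_energy // rho_indicator; congr (_ / Num.min _ _)%:E.
    by rewrite -s_sum1 [in LHS](bigID [in S]) /= addrC addrK.
  split; first exact: indicator_mx_projection.
  split=> /matrixP eqM.
    have [j jS] := card_gt0P S_gt0.
    have := eqM j j; rewrite indicator_mxE jS eqxx mxE => /eqP.
    by rewrite oner_eq0.
  have : (0 < #|~: S|)%N by rewrite cardsCs finset.setCK card_ord subn_gt0.
  move=> /card_gt0P[j]; rewrite inE => jS.
  have := eqM j j; rewrite indicator_mxE (negPf jS) eqxx mxE eqxx => /esym/eqP.
  by rewrite oner_eq0.
set mu := Order.min _ _.
have [mu_gap mu_off] :
    (mu <= graph_gap E gamma s)%E /\ (mu <= graph_offdiag E gamma s)%E.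
  by rewrite !ge_min !lexx orbT.
have sqrt_pair a b : Num.sqrt (s a * s b) = Num.sqrt (s a) * Num.sqrt (s b).
  by rewrite sqrtrM.
have edge_weight a b : (E a b)%:R * gamma a b = gamma a b.
  by case: (boolP (E a b)) => [_|/gamma_eq0->]; rewrite ?mul1r ?mulr0.
(* Nonnegativity and finiteness allow the extended real [mu] to be replaced by a real [c >= 0]. *)
have mu_ge0 : (0%:E <= mu)%E.
  rewrite le_min; apply/andP; split.
    apply: le_ereal_inf_tmp => _ [t _ <-]; rewrite lee_fin divr_ge0 //.
      by do 2!(apply: sumr_ge0 => ? _); exact: edge_ge0.
    by apply: sumr_ge0 => j _; rewrite mulr_ge0 ?normsq_ge0.
  apply: le_bigmin => [|[a b] _ /=]; first exact: leey.
  rewrite lee_fin edge_weight sqrt_pair mulr_ge0 ?offdiag_ge0 //.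
  by rewrite divr_ge0 ?addr_ge0 ?mulr_ge0 ?sqrtr_ge0.
have mu_fin : (mu < +oo)%E.
  apply: le_lt_trans mu_off _.
  have n_gt0 : (0 < n)%N by exact: ltnW.
  (* As [n >= 2], the pair of vertices 0 and 1 is in the range of the minimum, which is therefore
     not the default [+oo]. *)
  by rewrite /graph_offdiag (bigminD1 (Ordinal n_gt0, Ordinal n_ge2)) // gt_min ltry.
have mu_fin_num : mu \is a fin_num by rewrite ge0_fin_numE.
have [c_ge0 muE] : 0 <= fine mu /\ mu = (fine mu)%:E by rewrite fine_ge0 // fineK.
move: (fine mu) c_ge0 muE => c c_ge0 muE; rewrite muE in mu_gap mu_off *.
apply: le_ereal_inf_tmp => _ [P [P_proj [P_neq0 P_neq1]] <-].
rewrite -EFinM lee_fin.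
have m_gt0 := rho_projection_gt0 _ _ _ P_proj s s_gt0 P_neq0.
have : 0 < 1 - complex.Re (rho s P).
  rewrite -rhoB //; apply: rho_projection_gt0 => //.
    exact: orthogonal_projectionB.
  by move/eqP; rewrite subr_eq0 eq_sym => /eqP.
have : c * (complex.Re (rho s P) - complex.Re (rho s P) ^+ 2) <=
    complex.Re (kms s P (graph_generator E gamma s P)).
  rewrite {1}(rho_projection _ _ _ P_proj); apply: hermitian_energy_ge => //.
  - by case: P_proj.
  (* The infimum excludes [t = 0]; there the left side is zero and the right side nonnegative. *)
  - move=> t mean; have [->|/eqP t_neq0] := eqVneq t 0.
      rewrite [X in c * X]big1 => [|j _]; last first.
        by rewrite mxE normsqE /= expr0n addr0 mulr0.
      by rewrite mulr0; do 2!(apply: sumr_ge0 => ? _); exact: edge_ge0.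
    have : 0 < \sum_(j < n) s j * normsq (t ord0 j).
      have term_ge0 j : 0 <= s j * normsq (t ord0 j).
        by rewrite mulr_ge0 ?normsq_ge0.
      rewrite lt_neqAle sumr_ge0 // andbT eq_sym; apply/negP => /eqP sum0.
      apply: t_neq0; apply/rowP => j; rewrite mxE; apply/normsq_eq0/eqP.
      have /eqP : s j * normsq (t ord0 j) = 0 by apply: (psumr_eq0P _ sum0).
      by rewrite mulf_eq0 (gt_eqF (s_gt0 j)).
    move=> /ler_pdivlMr <-; rewrite -lee_fin; apply: le_trans mu_gap _.
    by apply: ereal_inf_lbound; exists t.
  (* The minimum only ranges over ordered pairs; the inequality is symmetric in [a] and [b]. *)
  - move=> a b; wlog ltab : a b / (a < b)%N => [hw|_].
      rewrite neq_ltn => /orP[] lt_ab; first by apply: hw; rewrite // neq_ltn lt_ab.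
      rewrite gamma_sym [s a + _]addrC [wdegree _ _ _ a + _]addrC.
      rewrite [Num.sqrt (s a) * _]mulrC.
      by apply: hw; rewrite // neq_ltn lt_ab.
    rewrite -ler_pdivlMr ?addr_gt0 // -lee_fin; apply: le_trans mu_off _.
    rewrite /graph_offdiag (bigminD1 (a, b)) // ge_min; apply/orP; left.
    by rewrite /= lee_fin edge_weight sqrt_pair [_ / _ * _]mulrAC.
move: m_gt0; set m := complex.Re (rho s P) => m_gt0 energy_ge m_lt1.
rewrite ler_pdivlMr ?lt_min ?m_gt0 //; apply: le_trans energy_ge.
rewrite [2^-1 * c]mulrC -mulrA ler_wpM2l //.
(* The product [m * (1 - m)] is the smaller factor times the larger, and the larger is at least 1/2:
   this is the source of the constant 1/2. *)
by case: (leP m (1 - m)) => h; nra.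
Qed.
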